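(* Let $H$ be a connected hypergraph and let $n\in\mathbb{N}$ with $n\geq 2$. Then $b_{L,\frac{1}{n}}(H)\leq \left\lceil\frac{|V(H)|}{n}\right\rceil$.
   Context: A hypergraph $H=(V(H),E(H))$ has a finite nonempty vertex set and a finite collection $E(H)$ of subsets of $V(H)$ called edges (parallel edges allowed); two vertices are adjacent if they lie in a common edge, and $H$ is connected if any two vertices are joined by a path of adjacent vertices. For a proportion $p\in(0,1)$, the proportion-based propagation rule is: if at some time step at least $\lceil p|e|\rceil$ vertices of an edge $e$ are on fire, then in the next time step all vertices of $e$ catch fire; burned vertices stay burned. A set $S\subseteq V(H)$ is a lazy burning set if, setting all of $S$ on fire at once and then repeatedly applying the propagation rule, every vertex eventually catches fire; $b_{L,p}(H)$ is the minimum size of a lazy burning set. *)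

(* Defs.v *)
From HB Require Import structures.
From mathcomp Require Import all_boot all_order all_algebra.
From mathcomp Require Import boolp reals.

Set Implicit Arguments.
Unset Strict Implicit.
Unset Printing Implicit Defensive.

Import Order.TTheory GRing.Theory Num.Theory.
Local Open Scope ring_scope.

(* Edges form a finite indexed family, so parallel edges are allowed; empty
   and singleton edges are allowed as well. *)
Record hypergraph := Hypergraph {
  vertex : finType;
  edge : finType;
  edge_set : edge -> {set vertex};
  vertex_nonempty : (0 < #|vertex|)%N }.

Definition adjacent (H : hypergraph) : rel (vertex H) :=
  fun x y => [exists e : edge H, (x \in edge_set e) && (y \in edge_set e)].

Definition connected (H : hypergraph) : Prop :=
  forall x y : vertex H, connect (@adjacent H) x y.

Section LazyBurning.
Variables (R : realType) (p : R) (H : hypergraph).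
Implicit Types S B : {set vertex H}.

Definition ignites B (e : edge H) : bool :=
  Num.ceil (p * #|edge_set e|%:R) <= #|edge_set e :&: B|%:Z.

Definition propagate B : {set vertex H} :=
  B :|: \bigcup_(e : edge H | ignites B e) edge_set e.

Definition burned S (t : nat) : {set vertex H} := iter t propagate S.

Definition lazy_burning_set S : Prop :=
  forall v : vertex H, exists t : nat, v \in burned S t.

Lemma lazy_burning_setT : lazy_burning_set [set: vertex H].
Proof. by move=> v; exists 0%N; rewrite inE. Qed.

(* The minimum is over a nonempty family, by [lazy_burning_setT]. *)
Definition lazy_burning_number : nat :=
  #|[arg min_(S < [set: vertex H] | `[< lazy_burning_set S >]) #|S|]|.

Lemma lazy_burning_numberP :
  (exists2 S, lazy_burning_set S & #|S| = lazy_burning_number) /\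
  (forall S, lazy_burning_set S -> (lazy_burning_number <= #|S|)%N).
Proof.
rewrite /lazy_burning_number; case: arg_minnP => [|S /asboolP lS minS].
  exact/asboolP/lazy_burning_setT.
by split=> [|T lT]; [exists S | apply/minS/asboolP].
Qed.

End LazyBurning.

(* Main.v *)
(** Grow a burned set from a single vertex.  By connectedness, as long as the
    burned set [B] is not everything, some edge [e] meets both [B] and its
    complement.  Adding [#|e :\: B| %/ n] vertices of [e :\: B] to the initial
    set makes [e] ignite, because [e] already has a burned vertex, which makes
    up for the rounding.  So each step burns at least [n] new vertices
    per added source, and only the first vertex is charged in full. *)
Require Import Defs.
From mathcomp Require Import all_boot all_order all_algebra.
From mathcomp Require Import boolp reals.
From mathcomp Require Import zify.

Import Order.TTheory GRing.Theory Num.Theory.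
Local Open Scope ring_scope.

(** An integer bounds a ceiling exactly when it bounds the real number inside, so the threshold
    becomes an inequality in [nat]. *)
Lemma ignites_invE {R : realType} {H : hypergraph} {n : nat}
  (B : {set vertex H}) (e : edge H) : (0 < n)%N ->
  ignites (1 / n%:R : R) B e = (#|edge_set e| <= n * #|edge_set e :&: B|)%N.
Proof.
move=> n0; rewrite /ignites ceil_le_int -pmulrn mul1r mulrC.
by rewrite ler_pdivrMr ?ltr0n // -natrM ler_nat mulnC.
Qed.

Lemma propagate_mono {R : realType} {p : R} {H : hypergraph}
  {A B : {set vertex H}} :
  A \subset B -> propagate p A \subset propagate p B.
Proof.
move=> sAB; apply: setUSS => //; apply/bigcupsP => e ieA.
apply: bigcup_sup; apply: le_trans ieA _.
by rewrite lez_nat subset_leq_card // setIS.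
Qed.

Lemma burned_mono {R : realType} (p : R) {H : hypergraph}
  {A B : {set vertex H}} (t : nat) :
  A \subset B -> burned p A t \subset burned p B t.
Proof. by move=> sAB; elim: t => //= t; apply: propagate_mono. Qed.

Lemma burned_source {R : realType} (p : R) {H : hypergraph}
  (S : {set vertex H}) (t : nat) : S \subset burned p S t.
Proof.
by elim: t => //= t /subset_trans; apply; apply: subsetUl.
Qed.

(** If no edge crossed the boundary of [B], then [B] would be closed under adjacency and so contain
    everything reachable from its vertex [x]. *)
Lemma connected_crossing_edge {H : hypergraph} {B : {set vertex H}} :
  connected H -> B != set0 -> B != setT ->
  exists2 e : edge H, edge_set e :&: B != set0 & ~~ (edge_set e \subset B).
Proof.
move=> cH /set0Pn[x xB] nBT.
suff /existsP[e /andP[]] : [exists e : edge H,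
    (edge_set e :&: B != set0) && ~~ (edge_set e \subset B)] by exists e.
apply: contraR nBT => /existsPn noe; apply/eqP/setP => y; rewrite inE.
have clB : closed (@adjacent H) (mem B).
  apply: intro_closed => [u v|u v]; first by rewrite !cH.
  move=> /existsP[e /andP[ue ve]] uB.
  have := noe e; rewrite negb_and !negbK => /orP[/eqP/setP/(_ u)|/subsetP->//].
  by rewrite !inE ue uB.
by rewrite -(closed_connect clB (cH x y)).
Qed.

Lemma exists_subset_card {T : finType} {A : {set T}} {k : nat} :
  (k <= #|A|)%N -> exists2 B : {set T}, B \subset A & #|B| = k.
Proof.
case/card_geqP => s [us <- sA]; exists [set x in s].
  by apply/subsetP => x; rewrite inE => /sA.
by rewrite cardsE; apply/card_uniqP.
Qed.

(** The invariant is the division-free form of [#|S|] being at most the ceiling of [#|B| / n]. *)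
Lemma burned_extend {R : realType} {H : hypergraph} {n : nat}
  {S : {set vertex H}} {t : nat} (p := 1 / n%:R : R) (B := burned p S t) :
  connected H -> (0 < n)%N -> B != set0 -> B != setT ->
  (n * #|S| < #|B| + n)%N ->
  exists S' : {set vertex H}, (#|B| < #|burned p S' t.+1|)%N /\
    (n * #|S'| < #|burned p S' t.+1| + n)%N.
Proof.
move=> cH n0 B0 BT ltS.
have [e eB eNB] := connected_crossing_edge cH B0 BT.
have [T sT cT] := exists_subset_card (leq_div #|edge_set e :\: B| n).
(* The new sources burn from time 0; by monotonicity the rerun has burned at least [B] and [T] at
   time [t]. *)
pose B' := burned p (S :|: T) t.
have sBB' : B \subset B' by rewrite burned_mono ?subsetUl.
have sTB' : T \subset B'.
  exact: subset_trans (subsetUr _ _) (burned_source _ _ _).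
have ign : ignites p B' e.
  rewrite ignites_invE // -(cardsID B (edge_set e)).
  rewrite -(cardsID B (edge_set e :&: B')).
  have le1 : (#|edge_set e :&: B| <= #|edge_set e :&: B' :&: B|)%N.
    by rewrite subset_leq_card // -setIA (setIidPr sBB').
  have le2 : (#|T| <= #|(edge_set e :&: B') :\: B|)%N.
    apply/subset_leq_card/subsetP => x xT; have := subsetP sT x xT.
    by rewrite !inE (subsetP sTB' x xT) andbT.
  apply: (@leq_trans (n * (#|edge_set e :&: B| + #|T|))); last first.
    by rewrite leq_mul2l leq_add ?orbT.
  (* With [b < (q + 1) * n] and [0 < a], the claim [a + b <= n * (a + q)] follows from
     [a + (n - 1) <= n * a]. *)
  rewrite cT; move: eB; rewrite -card_gt0.
  have := ltn_ceil #|edge_set e :\: B| n0.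
  by move: #|_ :&: B| #|_ :\: B| (_ %/ n)%N => a b q; nia.
have sub : B :|: edge_set e \subset burned p (S :|: T) t.+1.
  by rewrite setUSS // (bigcup_sup e).
have cBe : #|B :|: edge_set e| = (#|B| + #|edge_set e :\: B|)%N.
  by rewrite -(cardsID B (B :|: edge_set e)) setUK setDUl setDv set0U.
have := subset_leq_card sub; rewrite cBe => leB.
have e_gt0 : (0 < #|edge_set e :\: B|)%N by rewrite card_gt0 setD_eq0.
exists (S :|: T); split; first by lia.
have : (n * #|S :|: T| <= n * #|S| + n * #|T|)%N.
  by rewrite -mulnDr leq_mul2l leq_card_setU orbT.
have : (n * #|T| <= #|edge_set e :\: B|)%N by rewrite cT mulnC leq_divM.
lia.
Qed.

Lemma exists_burning_source (R : realType) {H : hypergraph} {n : nat} :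
  connected H -> (0 < n)%N ->
  exists (S : {set vertex H}) t, burned (1 / n%:R : R) S t = setT /\
    (n * #|S| < #|vertex H| + n)%N.
Proof.
move=> cH n0.
(* Induction on a lower bound for the burned set; the value [#|vertex H| - 1] forces it to be
   everything. *)
suff grow k : (k < #|vertex H|)%N -> exists (S : {set vertex H}) t,
    (k < #|burned (1 / n%:R : R) S t|)%N /\
    (n * #|S| < #|burned (1 / n%:R : R) S t| + n)%N.
  have VH := vertex_nonempty H.
  have [|S [t [ltB ltS]]] := grow #|vertex H|.-1; first by rewrite prednK.
  exists S, t; suff BT : burned (1 / n%:R : R) S t = setT.
    by split=> //; rewrite BT cardsT in ltS.
  by apply/eqP; rewrite eqEcard subsetT cardsT -(prednK VH).
elim: k => [/card_gt0P[x _]|k IHk ltk].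
  (* The summand [n] of the invariant pays for this first source: [n < 1 + n]. *)
  by exists [set x], 0%N; rewrite /= cards1 muln1 add1n.
have [S [t [ltB ltS]]] := IHk (ltnW ltk).
have [BT|BT] := eqVneq (burned (1 / n%:R : R) S t) setT.
  by exists S, t; split=> //; rewrite BT cardsT.
have B0 : burned (1 / n%:R : R) S t != set0.
  by rewrite -card_gt0 (leq_ltn_trans _ ltB).
have [S' [ltB' ltS']] := burned_extend cH n0 B0 BT ltS.
by exists S', t.+1; split=> //; apply: leq_ltn_trans ltB'.
Qed.

Theorem theorem2p22 (R : realType) (H : hypergraph) (n : nat)
  (Hconn : connected H) (hn : (2 <= n)%N) :
  (lazy_burning_number (1 / n%:R : R) H)%:Z
    <= Num.ceil (#|vertex H|%:R / n%:R : R).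
Proof.
have n0 : (0 < n)%N by apply: ltnW.
have [S [t [BT ltS]]] := exists_burning_source R Hconn n0.
have lS : lazy_burning_set (1 / n%:R : R) S.
  by move=> v; exists t; rewrite BT inE.
apply: (@le_trans _ _ #|S|%:Z).
  by rewrite lez_nat; apply: (lazy_burning_numberP _ _).2.
(* For [#|S| = s + 1], the goal amounts to [s < #|vertex H| / n], which is the invariant with one
   [n] cancelled. *)
case: #|S| ltS => [_|s ltS].
  by rewrite ceil_ge0 (@lt_le_trans _ _ 0) ?ltrN10 // divr_ge0 ?ler0n.
rewrite -addn1 PoszD lezD1 ceil_gt_int -pmulrn ltr_pdivlMr ?ltr0n //.
by rewrite -natrM ltr_nat mulnC; move: ltS; rewrite mulnS; lia.
Qed.
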